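(* Suppose $\sum_{n}\frac{|a_n|}{\lambda_n}<\infty$ and fix a compact interval $I=[\alpha_0,\alpha_1]\subset(0,1)$. Suppose that for some $m\in\mathbb{N}$, $m\ge1$, one has $S_1=\cdots=S_{m-1}=0$ and $S_m\ne0$, and that $c_m(\alpha)=\frac{(-1)^{m+1}}{\Gamma(1-m\alpha)}\ne0$ for all $\alpha\in I$. Let $\rho>1$, fix the true order $\alpha\in I$, and let $d_1=M_\alpha(t)$, $d_2=M_\alpha(\rho t)$. For any fixed $\delta>0$, define noisy data $\widetilde d_1=d_1+\delta$ and $\widetilde d_2=d_2+\delta$. Then $$-\frac{1}{m\log\rho}\log\left|\frac{\widetilde d_2}{\widetilde d_1}\right|\longrightarrow0,\qquad t\to\infty.$$ Hence no time-uniform consistency statement for the log-ratio estimator $-\frac{1}{m\log\rho}\log|\widetilde d_2/\widetilde d_1|$ (as an estimator of $\alpha$) is possible under fixed nonzero additive noise.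
   Context: Let $H$ be a real separable Hilbert space and $\mathcal{A}:\operatorname{Dom}(\mathcal{A})\subset H\to H$ a self-adjoint, strictly positive operator with compact resolvent, with eigenvalues counted with multiplicity $0<\lambda_1\le\lambda_2\le\cdots$ and an orthonormal eigenbasis $\{v_n\}$, $\mathcal{A}v_n=\lambda_nv_n$; in infinite dimensions $\lambda_n\to\infty$, and in finite dimensions the list of eigenvalues is finite and all spectral sums terminate accordingly. Let $\{a_n\}\subset\mathbb{R}$ be real coefficients. The resolvent moments are $S_k=\sum_{n}\frac{a_n}{\lambda_n^k}$, $k\ge1$. The scalar observation is $M_\alpha(t)=\sum_{n}a_nE_{\alpha,1}(-\lambda_nt^\alpha)$, $t>0$, $\alpha\in(0,1)$, where $E_{\alpha,1}(z)=\sum_{i\ge0}z^i/\Gamma(\alpha i+1)$ is the Mittag-Leffler function. The function $1/\Gamma$ is the entire reciprocal gamma function, vanishing at non-positive integers. *)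

(* Defs.v *)
From HB Require Import structures.
From mathcomp Require Import all_boot all_order all_algebra.
From mathcomp Require Import all_classical all_reals all_analysis.

Set Implicit Arguments.
Unset Strict Implicit.
Unset Printing Implicit Defensive.

Import Order.TTheory GRing.Theory Num.Theory numFieldNormedType.Exports.

Local Open Scope classical_set_scope.
Local Open Scope ring_scope.

Section HilbertSpace.
Context {R : realType} {H : completeNormedModType R}.

(* A real Hilbert space is a complete normed space whose norm comes from a
   real inner product. *)
Definition is_inner_product (dot : {dot H for @idfun R}) : Prop :=
  forall x, dot x x = `|x| ^+ 2.

Definition separable : Prop := exists2 S : set H, countable S & dense S.

(* An unbounded operator is a pair of a domain D and a function A : H -> H whose
   values outside D are irrelevant. *)
Definition linear_on (D : set H) (A : H -> H) : Prop :=
  D 0 /\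
  forall (c : R) (x y : H), D x -> D y ->
    D (c *: x + y) /\ A (c *: x + y) = c *: A x + A y.

(* The right-hand side of the equivalence is the graph of A, the left-hand side
   that of its adjoint, so this is A* = A including equality of domains. *)
Definition self_adjoint (dot : {dot H for @idfun R}) (D : set H) (A : H -> H)
    : Prop :=
  dense D /\
  forall y z : H,
    (forall x, D x -> dot (A x) y = dot x z) <-> (D y /\ A y = z).

Definition strictly_positive (dot : {dot H for @idfun R}) (D : set H)
    (A : H -> H) : Prop :=
  forall x, D x -> x != 0 -> 0 < dot (A x) x.

Definition compact_operator (K : H -> H) : Prop :=
  forall B : set H, bounded_set B -> precompact (K @` B).

(* Some mu lies in the resolvent set and K = (A - mu)^-1 is compact. *)
Definition compact_resolvent (D : set H) (A : H -> H) : Prop :=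
  exists (mu : R) (K : {linear H -> H}),
    [/\ forall x, D (K x) /\ A (K x) - mu *: K x = x,
        forall x, D x -> K (A x - mu *: x) = x
      & compact_operator K].

End HilbertSpace.

Arguments separable {R} H.

(* The spectral indices are 0, 1, 2, ... when N = None (infinite dimension) and
   0, ..., d-1 when N = Some d; the first eigenvalue thus has index 0. *)
Definition spectral_index (N : option nat) (n : nat) : bool :=
  if N is Some d then (n < d)%N else true.

Record eigensystem {R : realType} {H : completeNormedModType R}
    (dot : {dot H for @idfun R}) (D : set H) (A : H -> H)
    (N : option nat) (lambda : nat -> R) (v : nat -> H) : Prop := {
  eigenvalue_gt0 : forall n, spectral_index N n -> 0 < lambda n ;
  eigenvalue_le : forall n, spectral_index N n.+1 -> lambda n <= lambda n.+1 ;
  eigenvalue_cvg : N = None -> lambda @ \oo --> +oo ;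
  eigenvectorP : forall n, spectral_index N n ->
    D (v n) /\ A (v n) = lambda n *: v n ;
  eigenbasis_orthonormal : forall i j, spectral_index N i ->
    spectral_index N j -> dot (v i) (v j) = (i == j)%:R ;
  eigenbasis_complete : forall x : H,
    (\sum_(0 <= k < n | spectral_index N k) dot x (v k) *: v k) @[n --> \oo]
      --> x }.

Section SpectralSums.
Context {R : realType}.

(* Euler's integral; only meaningful for x > 0. *)
Definition Gamma (x : R) : R :=
  \int[lebesgue_measure]_(t in `]0, +oo[) (t `^ (x - 1) * expR (- t)).

(* 1 / Gamma on the whole real line:
   1 / Gamma x = x (x + 1) ... (x + k - 1) / Gamma (x + k),
   with k the least natural number such that x + k > 0. *)
Definition rGamma (x : R) : R :=
  let k := Num.truncn (1 - x) in
  (\prod_(0 <= i < k) (x + i%:R)) / Gamma (x + k%:R).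

Definition mittag_leffler (alpha beta z : R) : R :=
  limn (series (fun i => z ^+ i * rGamma (alpha * i%:R + beta))).

Definition spectral_sum (N : option nat) (f : nat -> R) : R :=
  limn (fun n => \sum_(0 <= k < n | spectral_index N k) f k).

Definition resolvent_moment (N : option nat) (lambda a : nat -> R) (k : nat)
    : R :=
  spectral_sum N (fun n => a n / lambda n ^+ k).

Definition observation (N : option nat) (lambda a : nat -> R) (alpha t : R)
    : R :=
  spectral_sum N
    (fun n => a n * mittag_leffler alpha 1 (- (lambda n * t `^ alpha))).

Definition asymptotic_coef (m : nat) (alpha : R) : R :=
  (-1) ^+ m.+1 * rGamma (1 - m%:R * alpha).

Definition log_ratio_estimator (m : nat) (rho d1 d2 : R) : R :=
  - (m%:R * ln rho)^-1 * ln `|d2 / d1|.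

(* est delta t is the estimate at time t under noise of size delta: it
   approaches alpha as the noise vanishes, uniformly over all late times. *)
Definition time_uniformly_consistent (est : R -> R -> R) (alpha : R) : Prop :=
  exists2 T : R, 0 < T &
    forall eps : R, 0 < eps -> exists2 delta0 : R, 0 < delta0 &
      forall delta : R, 0 < delta < delta0 ->
        forall t : R, T <= t -> `|est delta t - alpha| < eps.

End SpectralSums.

(* Main.v *)
Require Import Defs.
From HB Require Import structures.
From mathcomp Require Import all_boot all_order all_algebra.
From mathcomp Require Import all_classical all_reals all_analysis.
From mathcomp Require Import measurable_realfun ring lra.

(** Why it is true.  Everything follows from M t --> 0: then both noisy data
    tend to delta, their ratio tends to 1, and the logarithm of the ratio tends
    to 0, which differs from alpha > 0.  Uniform consistency fails because at
    any fixed noise level the late estimates are near 0.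

    Since the weights |a_n| / lambda_n are summable, M t = O(t^-alpha) as soon
    as |E_alpha(-x)| <= C / x for x > 0, where E_alpha is the Mittag-Leffler
    function.  This bound ([mittag_leffler_decay]) is the core of the file, and
    is obtained with no complex analysis by discretizing the fractional
    relaxation equation, whose solution is t |-> E_alpha(-t^alpha).

    Let (1 - z)^(-b) have coefficients [nbinom b n].  For 0 <= y < 1, the
    coefficients of
      u(z) = (1 - z)^(-1) / (1 + y (1 - z)^(-alpha))
           = (1 - z)^(alpha - 1) / ((1 - z)^alpha + y)
    form the implicit discrete solution.  All the coefficients of
    1 - (1 - z)^alpha are nonnegative, so those of
    e(z) = 1 / ((1 - z)^alpha + y) are nonnegative
    ([relax_coef_alpha_ge0]); hence u_n >= 0, and u_n is nonincreasing because
    (1 - z) u(z) = 1 - y e(z).  Reading off coefficients in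
    u(z) (1 + y (1 - z)^(-alpha)) = 1 / (1 - z) and using monotonicity gives
      u_n (1 + y nbinom (1 + alpha) n) <= 1        ([relax_coef1_le]).

    It remains to pass to the limit.  Expanding u_n in powers of y with
    y = x / n^alpha, the k-th term is
    (-x)^k nbinom (alpha k + 1) n / n^(alpha k), and Gauss's limit formula
    ([euler_ratio_cvg]), proved from Euler's integral by dominated convergence,
    says that it tends to (-x)^k / Gamma (alpha k + 1).  The ratios in Gauss's
    formula decrease with n ([euler_ratio_noninc]), which provides the
    domination for Tannery's theorem ([tannery]).  The limit of the discrete
    inequalities is
      0 <= E_alpha(-x)  and  E_alpha(-x) (1 + x / Gamma (alpha + 1)) <= 1. *)

Set Implicit Arguments.
Unset Strict Implicit.
Unset Printing Implicit Defensive.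

Import Order.TTheory GRing.Theory Num.Theory numFieldNormedType.Exports.

Local Open Scope classical_set_scope.
Local Open Scope ring_scope.

(** * Coefficients of the powers of 1 / (1 - z) *)

Section NegBinom.
Context {R : realType}.
Implicit Types b c : R.

(** The coefficient of z^n in (1 - z)^(-b), i.e. the binomial coefficient
    n + b - 1 over n. *)
Definition nbinom b (n : nat) : R :=
  \prod_(0 <= i < n) ((b + i%:R) / i.+1%:R).

Lemma nbinom0 b : nbinom b 0 = 1.
Proof. by rewrite /nbinom big_geq. Qed.

Lemma nbinomS b n : nbinom b n.+1 = nbinom b n * ((b + n%:R) / n.+1%:R).
Proof. by rewrite /nbinom big_nat_recr. Qed.

Lemma mul_nbinomS b n : n.+1%:R * nbinom b n.+1 = (b + n%:R) * nbinom b n.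
Proof. by rewrite nbinomS; field; rewrite nat1r pnatr_eq0. Qed.

Lemma nbinom_ge0 b n : 0 <= b -> 0 <= nbinom b n.
Proof.
by move=> b0; apply: prodr_ge0 => i _; rewrite divr_ge0 ?addr_ge0.
Qed.

Lemma nbinom_gt0 b n : 0 < b -> 0 < nbinom b n.
Proof.
by move=> b0; apply: prodr_gt0 => i _; rewrite divr_gt0 ?ltr_wpDr.
Qed.

Lemma nbinom_le b c n : 0 <= b -> b <= c -> nbinom b n <= nbinom c n.
Proof.
move=> b0 bc; apply: ler_prod => i _.
by rewrite divr_ge0 ?addr_ge0//= ler_wpM2r ?invr_ge0// lerD2r.
Qed.

Lemma nbinom_0 n : nbinom 0 n = (n == 0%N)%:R.
Proof.
case: n => [|n]; first by rewrite nbinom0.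
by rewrite /nbinom big_nat_recl// add0r !mul0r.
Qed.

Lemma nbinom_1 n : nbinom 1 n = 1.
Proof.
elim: n => [|n IH]; first by rewrite nbinom0.
by rewrite nbinomS IH mul1r nat1r divff// pnatr_eq0.
Qed.

(** For 0 <= b <= 1, this is the positivity of the coefficients of
    1 - (1 - z)^b, on which the discrete maximum principle rests. *)
Lemma nbinomN_le0 b n : 0 <= b <= 1 -> nbinom (- b) n.+1 <= 0.
Proof.
move=> /andP[b0 b1]; rewrite /nbinom big_nat_recl// addr0.
rewrite mulr_le0_ge0 ?divr1 ?oppr_le0//; apply: prodr_ge0 => i _.
by rewrite divr_ge0// -natr1; have := ler0n R i; lra.
Qed.

(** Vandermonde's identity for real exponents.  It follows from the first-order
    recursion [mul_nbinomS] when the factor n + 1 = j + (n + 1 - j) is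
    distributed over the convolution. *)
Lemma nbinom_conv b c n :
  \sum_(j < n.+1) nbinom b j * nbinom c (n - j) = nbinom (b + c) n.
Proof.
elim: n => [|n IH]; first by rewrite big_ord1 subnn !nbinom0 mulr1.
apply: (@mulfI _ n.+1%:R); first by rewrite pnatr_eq0.
rewrite mul_nbinomS -IH !mulr_sumr.
transitivity (\sum_(j < n.+2) (j%:R * nbinom b j) * nbinom c (n.+1 - j)
   + \sum_(j < n.+2) nbinom b j * ((n.+1 - j)%:R * nbinom c (n.+1 - j))).
  rewrite -big_split/=; apply: eq_bigr => -[j /= jn] _.
  rewrite natrB//; ring.
rewrite big_ord_recl/= !mul0r add0r [X in _ + X]big_ord_recr/= subnn mul0r mulr0.
rewrite addr0 -big_split/=; apply: eq_bigr => -[j /= jn] _.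
rewrite /bump/= add1n subSS mul_nbinomS subSn// mul_nbinomS natrB//; ring.
Qed.

Lemma nbinom_pascal b n : nbinom (b + 1) n.+1 = nbinom b n.+1 + nbinom (b + 1) n.
Proof.
rewrite -nbinom_conv big_ord_recr/= subnn nbinom0 mulr1 addrC; congr (_ + _).
rewrite -nbinom_conv; apply: eq_bigr => -[j /= jn] _.
by rewrite !nbinom_1.
Qed.

End NegBinom.

(** * Discrete fractional relaxation *)

Section Relaxation.
Context {R : realType}.
Variables (al y : R).
Hypotheses (al01 : 0 <= al <= 1) (y01 : 0 <= y < 1).

(* The k-th term of the geometric expansion in y of the z^n-coefficient of
   (1 - z)^(-b) / (1 + y (1 - z)^(-al)). *)
Let relax_term (b : R) n : R ^nat := fun k => (- y) ^+ k * nbinom (al * k%:R + b) n.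

(** The coefficient of z^n in (1 - z)^(-b) / (1 + y (1 - z)^(-al)).  In the
    notation of the introduction it is u_n for b = 1 and e_n for b = al. *)
Definition relax_coef b n : R := limn (series (relax_term b n)).

(** Pascal's rule bounds (1 - y) times the sum at n + 1 by 1 plus the sum at
    n. *)
Lemma bounded_sum_nbinom n : exists C : R,
  forall K, \sum_(0 <= k < K) y ^+ k * nbinom (k%:R + 2) n <= C.
Proof.
have [y0 y1] := andP y01; have y1' : 0 < 1 - y by rewrite subr_gt0.
elim: n => [|n [C IH]].
  exists (1 - y)^-1 => K.
  under eq_bigr do rewrite nbinom0 mulr1.
  rewrite -[leRHS]mul1r ler_pdivlMr//.
  rewrite big_mkord -opprB mulrN mulrC -subrX1 opprB.
  by rewrite lerBlDr lerDl exprn_ge0.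
exists ((1 + C) / (1 - y)) => K; rewrite ler_pdivlMr//.
set S := \sum_(_ <= _ < _) _.
suff : S <= 1 + y * S + C by lra.
have E (k : nat) : nbinom (k%:R + 2 : R) n.+1 =
    nbinom (k%:R + 1) n.+1 + nbinom (k%:R + 2) n.
  by rewrite (_ : k%:R + 2 = (k%:R + 1) + 1 :> R) ?nbinom_pascal//; ring.
rewrite {1}/S; under eq_bigr do rewrite E mulrDr.
rewrite big_split/= lerD//.
rewrite /S; case: K {S} => [|K]; first by rewrite !big_geq// mulr0 addr0.
rewrite big_nat_recl// add0r nbinom_1 mulr1 expr0 lerD2l.
rewrite mulr_sumr [leRHS]big_nat_recr//= ler_wpDr//.
  by rewrite !mulr_ge0 ?exprn_ge0 ?nbinom_ge0.
apply: ler_sum => k _; rewrite exprS mulrA.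
by rewrite (_ : k.+1%:R + 1 = k%:R + 2 :> R)// -natr1; ring.
Qed.

(** Exponents b up to 2 suffice: the largest one needed is 1 + al. *)
Lemma normed_relax_term_cvg b n : 0 <= b <= 2 ->
  cvgn [normed series (relax_term b n)].
Proof.
have [y0 y1] := andP y01; have [a0 a1] := andP al01.
move=> /andP[b0 b2]; have [C HC] := bounded_sum_nbinom n.
apply: nondecreasing_is_cvgn.
  by apply: nondecreasing_series => k _ _ /=.
exists C => _ [K _ <-]; apply: le_trans (HC K).
rewrite /series/=; apply: ler_sum => k _.
rewrite normrM normrX normrN (ger0_norm y0) ler_wpM2l ?exprn_ge0//.
have ? : 0 <= al * k%:R by rewrite mulr_ge0.
rewrite ger0_norm ?nbinom_ge0 ?addr_ge0//.
by apply: nbinom_le; rewrite ?addr_ge0// lerD// ler_piMl.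
Qed.

Lemma relax_coef_cvg b n : 0 <= b <= 2 ->
  series (relax_term b n) @ \oo --> relax_coef b n.
Proof. by move=> b02; apply: normed_cvg; exact: normed_relax_term_cvg. Qed.

(** Multiplication of the generating function by (1 - z)^(-c), where c may be
    negative. *)
Lemma relax_coef_conv b c n : 0 <= b <= 2 -> 0 <= b + c <= 2 ->
  \sum_(j < n.+1) nbinom c j * relax_coef b (n - j) = relax_coef (b + c) n.
Proof.
move=> b02 bc02; apply/esym/cvg_lim => //.
rewrite (_ : series (relax_term (b + c) n) =
  fun K => \sum_(j < n.+1) nbinom c j * series (relax_term b (n - j)) K); last first.
  apply/funext => K; rewrite /series/=; under [RHS]eq_bigr do rewrite mulr_sumr.
  rewrite exchange_big/=; apply: eq_bigr => k _; rewrite /relax_term.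
  rewrite addrA addrC -nbinom_conv mulr_sumr; apply: eq_bigr => j _; ring.
apply: cvg_big => [|j _]; first exact: add_continuous.
apply: cvgMl_tmp; exact: relax_coef_cvg.
Qed.

(** From 1 / (1 + w) = 1 - w / (1 + w) with w = y (1 - z)^(-al). *)
Lemma relax_coef_shift b n : 0 <= b -> b + al <= 2 ->
  relax_coef b n = nbinom b n - y * relax_coef (b + al) n.
Proof.
have [a0 a1] := andP al01.
move=> b0 b2.
have b02 : 0 <= b <= 2 by apply/andP; split => //; lra.
have ba02 : 0 <= b + al <= 2 by apply/andP; split => //; lra.
apply/cvg_lim => //.
rewrite -cvg_shiftS.
rewrite (_ : (fun _ => _) =
    (fun K => nbinom b n - y * series (relax_term (b + al) n) K)).
  apply: cvgB; first exact: cvg_cst.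
  apply: cvgMl_tmp; exact: relax_coef_cvg.
apply/funext => K; rewrite /series/= big_nat_recl// /relax_term expr0 mul1r mulr0 add0r.
congr (_ + _); rewrite mulr_sumr -sumrN; apply: eq_bigr => k _.
by rewrite exprS -natr1 mulrDr mulr1 -addrA (addrC al); ring.
Qed.

(** From e(z) ((1 - z)^al + y) = 1, the coefficient (1 + y) e_n is a
    combination of the earlier e_j with the nonnegative weights
    - nbinom (- al) j, plus 1 if n = 0. *)
Lemma relax_coef_alpha_ge0 n : 0 <= relax_coef al n.
Proof.
have [a0 a1] := andP al01; have [y0 y1] := andP y01.
elim/ltn_ind: n => n IH.
have al02 : 0 <= al <= 2 by rewrite a0; lra.
have /(_ n) := relax_coef_conv (c := - al) _ al02.
rewrite subrr lexx ler0n => /(_ isT).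
rewrite relax_coef_shift// ?add0r ?nbinom_0; last lra.
rewrite big_ord_recl/= subn0 nbinom0 mul1r => /(canRL (addrK _)).
set e := relax_coef al n => E.
suff : 0 <= (1 + y) * e by rewrite pmulr_rge0// ltr_wpDr.
rewrite (_ : (1 + y) * e = (n == 0)%:R +
    \sum_(i < n) - nbinom (- al) (bump 0 i) * relax_coef al (n - bump 0 i)).
  apply: addr_ge0 => //; apply: sumr_ge0 => -[i /= ni] _.
  rewrite /bump/= add1n mulr_ge0 ?oppr_ge0 ?nbinomN_le0 ?IH//.
  by rewrite ltn_subrL (leq_trans _ ni).
under eq_bigr do rewrite mulNr; rewrite sumrN mulrDl mul1r {1}E; ring.
Qed.

(** The z^n-coefficient of u(z) = (1 - y e(z)) / (1 - z). *)
Lemma relax_coef1E n : relax_coef 1 n = 1 - y * \sum_(j < n.+1) relax_coef al (n - j).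
Proof.
have [a0 a1] := andP al01.
have -> : \sum_(j < n.+1) relax_coef al (n - j) = relax_coef (1 + al) n.
  rewrite addrC -relax_coef_conv ?a0//=; [|lra|lra].
  by apply: eq_bigr => j _; rewrite nbinom_1 mul1r.
by rewrite relax_coef_shift ?nbinom_1//; lra.
Qed.

Lemma relax_coef1_noninc n k : (k <= n)%N -> relax_coef 1 n <= relax_coef 1 k.
Proof.
have [y0 y1] := andP y01.
move=> kn; have h : nonincreasing_seq (relax_coef 1).
  apply/nonincreasing_seqP => j; rewrite !relax_coef1E lerD2l lerN2 ler_wpM2l//.
  by rewrite [leRHS]big_ord_recl subn0 ler_wpDl// relax_coef_alpha_ge0.
exact: h.
Qed.

(** Since u(z) = (1 - z)^(al - 1) e(z) and 1 - al >= 0. *)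
Lemma relax_coef1_ge0 n : 0 <= relax_coef 1 n.
Proof.
have [a0 a1] := andP al01.
rewrite -(subrK al 1) addrC -relax_coef_conv; [|lra|lra].
by apply: sumr_ge0 => j _; rewrite mulr_ge0 ?relax_coef_alpha_ge0 ?nbinom_ge0 ?subr_ge0.
Qed.

(** In u_n + y sum_j nbinom al j u_(n-j) = 1, replace every u_(n-j) by the
    smaller u_n; the remaining sum of binomials is nbinom (1 + al) n. *)
Lemma relax_coef1_le n : relax_coef 1 n * (1 + y * nbinom (1 + al) n) <= 1.
Proof.
have [a0 a1] := andP al01; have [y0 y1] := andP y01.
have E : 1 = relax_coef 1 n + y * relax_coef (1 + al) n.
  by rewrite relax_coef_shift ?nbinom_1 ?subrK//; lra.
rewrite [leRHS]E.
rewrite mulrDr mulr1 lerD2l mulrCA ler_wpM2l// -nbinom_conv mulr_sumr.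
rewrite -relax_coef_conv; [|lra|lra].
rewrite [leLHS](reindex_inj rev_ord_inj)/=; apply: ler_sum => -[j /= jn] _.
rewrite subSS nbinom_1 mul1r subKn// mulrC ler_wpM2l ?nbinom_ge0//.
by apply: relax_coef1_noninc; exact: leq_subr.
Qed.

End Relaxation.

(** * Gauss's limit formula for Euler's integral *)

Section Euler.
Context {R : realType}.
Implicit Types b c t : R.
Notation mu := (@lebesgue_measure R).

Lemma nbinom_shift c n : (c + n%:R) * nbinom c n = c * nbinom (c + 1) n.
Proof.
elim: n => [|n IH]; first by rewrite !nbinom0 addr0.
rewrite !nbinomS [RHS]mulrA -IH -natr1; ring.
Qed.

Lemma powR_LRcontinuous b c : 0 < b -> 0 < c ->
  derivable_oo_LRcontinuous (@powR R ^~ b) 0 c.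
Proof.
move=> b0 c0; split.
- by move=> x /[!in_itv]/= /andP[x0 _]; apply: derivable_powR; rewrite in_itv/= x0.
- by rewrite powR0 ?gt_eqF//; exact: powR_cvg0.
- apply: cvg_at_left_filter; have : derivable (@powR R ^~ b) c 1.
    by apply: derivable_powR; rewrite in_itv/= c0.
  by move/derivable1_diffP/differentiable_continuous.
Qed.

Lemma powR_within_continuous b c : 0 <= b -> 0 < c ->
  {within `[0, c], continuous (@powR R ^~ b)}.
Proof.
rewrite le_eqVlt => /predU1P[<- c0|b0 c0].
  rewrite (_ : @powR R ^~ 0 = cst 1); last by apply/funext => x /=; rewrite powRr0.
  by apply: continuous_subspaceT => x; exact: cvg_cst.
exact/derivable_oo_LRcontinuous_within/powR_LRcontinuous.
Qed.

Lemma Rintegral_powR b c : 0 <= b -> 0 < c ->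
  \int[mu]_(t in `[0, c]) (t `^ b) = c `^ (b + 1) / (b + 1).
Proof.
move=> b0 c0; have b1 : 0 < b + 1 by rewrite ltr_wpDl.
rewrite /Rintegral (@continuous_FTC2 _ _ (fun t => t `^ (b + 1) / (b + 1)))//.
- by rewrite powR0 ?gt_eqF// mul0r/= subr0.
- exact: powR_within_continuous.
- have [h1 h2 h3] := powR_LRcontinuous b1 c0; split.
  + by move=> x xc; apply: derivableM; [exact: h1|exact: derivable_cst].
  + exact: cvgMr_tmp.
  + exact: cvgMr_tmp.
- move=> x /[!in_itv]/= /andP[x0 _].
  rewrite derive1E deriveM; last 2 first.
    by apply: derivable_powR; rewrite in_itv/= x0.
    exact: derivable_cst.
  rewrite derive_cst scaler0 add0r.
  rewrite -derive1E powR_derive1 ?in_itv/= ?x0// addrK.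
  by rewrite /GRing.scale/= mulrA mulVf ?mul1r// gt_eqF.
Qed.

(** For m = c = n this tends to Euler's integral for Gamma (b + 1), because
    (1 - t / n)^n tends to exp (- t). *)
Definition euler_beta c b m := \int[mu]_(t in `[0, c]) (t `^ b * (1 - t / c) ^+ m).

Lemma euler_integrable c b m : 0 < c -> 0 <= b ->
  mu.-integrable `[0, c] (EFin \o (fun t => t `^ b * (1 - t / c) ^+ m)).
Proof.
move=> c0 b0; apply: continuous_compact_integrable; first exact: segment_compact.
have h : {within `[0, c], continuous (fun t : R => (1 - t / c) ^+ m)}.
  apply: continuous_subspaceT => x.
  apply: (@continuous_comp _ _ _ (fun t => 1 - t / c) (fun t => t ^+ m));
    last exact: exprn_continuous.
  by apply: cvgB; [exact: cvg_cst|apply: cvgMr_tmp; exact: cvg_id].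
by move=> x; apply: cvgM; [exact: powR_within_continuous|exact: h].
Qed.

(** Splitting off one factor 1 - t / c gives a recursion on m that raises b
    by 1, so that only the integral of a power is needed at the bottom. *)
Lemma euler_betaE c b m : 0 < c -> 0 <= b ->
  euler_beta c b m = c `^ (b + 1) / ((b + 1) * nbinom (b + 2) m).
Proof.
move=> c0; elim: m b => [|m IH] b b0.
  rewrite nbinom0 mulr1 -Rintegral_powR//; apply: eq_Rintegral => t _.
  by rewrite expr0 mulr1.
have b10 : 0 <= b + 1 by rewrite addr_ge0.
have -> : euler_beta c b m.+1 = euler_beta c b m - c^-1 * euler_beta c (b + 1) m.
  rewrite /euler_beta -RintegralZl//; last exact: euler_integrable.
  rewrite -RintegralB//; last 2 first.
    exact: euler_integrable.
    rewrite (_ : EFin \o _ = (fun t => c^-1%:E *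
      (EFin \o (fun t => t `^ (b + 1) * (1 - t / c) ^+ m)%R) t)%E)//.
    by apply: integrableZl => //; exact: euler_integrable.
  apply: eq_Rintegral => t /[!inE]/= /[!in_itv]/= /andP[t0 _].
  rewrite -(mulr_powRB1 t0 (_ : 0 < b + 1)) ?addrK; last by rewrite ltr_wpDl.
  by rewrite exprS; ring.
rewrite !IH// (powRD (r := b + 1) (s := 1)); last by rewrite gt_eqF// addr_gt0// ltr_wpDl.
rewrite powRr1 ?ltW// nbinomS.
have P0 : 0 < nbinom (b + 2) m by rewrite nbinom_gt0// ltr_wpDl.
have -> : nbinom (b + 1 + 2) m = (b + 2 + m%:R) * nbinom (b + 2) m / (b + 2).
  by rewrite nbinom_shift (_ : b + 1 + 2 = b + 2 + 1); [field; lra|ring].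
have := ler0n R m => m0; rewrite -natr1.
by field; rewrite !gt_eqF//; lra.
Qed.

(** The lower bound used in the squeeze is 1 - s >= exp (- s / (1 - s)). *)
Lemma expR_approx t : 0 <= t ->
  (if t <= n.+1%:R then (1 - t / n.+1%:R) ^+ n.+1 else 0) @[n --> \oo] -->
    expR (- t).
Proof.
move=> t0.
have tn0 : t / n.+1%:R @[n --> \oo] --> (0 : R).
  rewrite -(mulr0 t); apply: cvgMl_tmp; exact: cvg_harmonic.
apply: (@squeeze_cvgr _ _ _ _
  (fun n => expR (- (t / (1 - t / n.+1%:R)))) (cst (expR (- t)))).
- have : \forall n \near \oo, t / n.+1%:R < 1 by apply: (cvgr_lt 0).
  apply: filterS => n tn.
  have n0 : 0 < n.+1%:R :> R by [].
  have tlt : t < n.+1%:R by rewrite -(mul1r n.+1%:R) -ltr_pdivrMr.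
  have s0 : 0 < 1 - t / n.+1%:R by rewrite subr_gt0.
  rewrite (ltW tlt); apply/andP; split.
    have E (N : R) : 0 < N -> t < N ->
        - (t / (1 - t / N)) = N * - (t / N / (1 - t / N)).
      by move=> N0 tN; field; rewrite !gt_eqF//; lra.
    rewrite (E _ n0 tlt).
    rewrite expRM_natl lerXn2r ?nnegrE ?expR_ge0 ?(ltW s0)//.
    rewrite expRN -[leRHS]invrK lef_pV2 ?posrE ?expR_gt0 ?invr_gt0//.
    apply: le_trans (expR_ge1Dx _).
    have E' (u : R) : 0 < 1 - u -> (1 - u)^-1 = 1 + u / (1 - u).
      by move=> u1; field; rewrite gt_eqF//; lra.
    by rewrite {1}E'.
  have -> : - t = n.+1%:R * - (t / n.+1%:R) by rewrite mulrN mulrCA divff ?mulr1 ?gt_eqF.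
  by rewrite expRM_natl lerXn2r ?nnegrE ?expR_ge0 ?(ltW s0)// expR_ge1Dx.
- apply: continuous_cvg; first exact: continuous_expR.
  apply: cvgN; rewrite -[X in _ --> X](divr1 t); apply: cvgMl_tmp; apply: cvgV => //.
  by rewrite -[X in _ --> X](subr0 1); apply: cvgB; [exact: cvg_cst|].
- exact: cvg_cst.
Qed.

(** This turns the integrand of Gamma into a multiple of the exponential
    density of rate 1/2, whose integrability is known. *)
Lemma powR_expR_bound b t : 0 <= b -> 0 < t ->
  t `^ b <= (2 * (b + 1)) `^ b * expR (t / 2).
Proof.
move=> b0 t0; set s := 2 * (b + 1).
have s0 : 0 < s by rewrite mulr_gt0// ltr_wpDl.
rewrite -{1}(divfK (lt0r_neq0 s0) t) powRM ?(ltW s0)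
  ?divr_ge0 ?(ltW t0) ?(ltW s0)// mulrC.
rewrite ler_wpM2l ?powR_ge0// /powR gt_eqF ?divr_gt0// ler_expR.
apply: (@le_trans _ _ (b * (t / s))).
  by rewrite ler_wpM2l// ltW// ln_sublinear// divr_gt0.
rewrite mulrCA ler_wpM2l ?(ltW t0)// /s invfM mulrCA -[leRHS]mulr1.
by rewrite ler_wpM2l ?invr_ge0// ler_pdivrMr ?ltr_wpDl// mul1r; lra.
Qed.

Lemma euler_beta_cvg b : 0 <= b ->
  euler_beta n.+1%:R b n.+1 @[n --> \oo] --> Gamma (b + 1).
Proof.
move=> b0.
pose h (n : nat) t := t `^ b * (1 - t / n.+1%:R) ^+ n.+1.
pose g t := (2 * (2 * (b + 1)) `^ b) * exponential_pdf 2^-1 t.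
have hE n : euler_beta n.+1%:R b n.+1 =
    fine (\int[mu]_(t in `]0%R, +oo[) ((h n \_ `]0, n.+1%:R]) t)%:E).
  rewrite /euler_beta -Rintegral_itv_obnd_cbnd; last first.
    apply: integrableS (euler_integrable _ _ _) => //.
    by apply: subset_itvr; rewrite bnd_simp.
  rewrite /Rintegral; congr fine; rewrite [LHS]integral_mkcond [RHS]integral_mkcond.
  apply: eq_integral => t _ /=; rewrite !patchE.
  case: ifPn => [|_]; last by case: ifP.
  rewrite inE/= in_itv/= => /andP[t0 tn].
  by rewrite ifT// inE/= in_itv/= t0.
rewrite (_ : (fun _ => _) =
  fine \o (fun n => \int[mu]_(t in `]0%R, +oo[) ((h n \_ `]0, n.+1%:R]) t)%:E)%E); last first.
  by apply/funext => n; exact: hE.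
have [] := @dominated_convergence _ _ _ mu `]0, +oo[ _
  (fun n t => ((h n \_ `]0, n.+1%:R]) t)%:E) (fun t => (t `^ b * expR (- t))%:E)
  (EFin \o g).
- by [].
- move=> n; apply/measurable_EFinP; apply/measurable_restrict => //.
  apply: measurable_funTS; apply: measurable_funM; first exact: measurable_powR.
  apply: measurable_funX; apply: measurable_funB => //.
  by apply: measurable_funM.
- apply/measurable_EFinP; apply: measurable_funTS; apply: measurable_funM.
    exact: measurable_powR.
  exact: measurableT_comp.
- apply: aeW => t /= /[!in_itv]/= /andP[t0 _].
  apply: cvg_EFin; first by apply: nearW.
  rewrite (_ : fine \o _ = fun n => t `^ b *
      (if t <= n.+1%:R then (1 - t / n.+1%:R) ^+ n.+1 else 0)).
    by apply: cvgMl_tmp; apply: expR_approx; exact: ltW.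
  apply/funext => n /=; rewrite patchE mem_setE in_itv/= t0/=.
  by case: ifP => //; rewrite mulr0.
- rewrite (_ : EFin \o g = fun t =>
    ((2 * (2 * (b + 1)) `^ b)%:E * (EFin \o exponential_pdf 2^-1) t)%E)//.
  apply: integrableZl => //.
  by apply: (integrableS _ _ _ (integrable_exponential_pdf _)).
- apply: aeW => t n /= /[!in_itv]/= /andP[t0 _].
  rewrite lee_fin patchE mem_setE in_itv/= t0/=.
  have g0 : 0 <= g t by rewrite mulr_ge0 ?mulr_ge0 ?powR_ge0 ?exponential_pdf_ge0.
  case: ifPn => [tn|_]; last by rewrite normr0.
  have s0 : 0 <= 1 - t / n.+1%:R by rewrite subr_ge0 ler_pdivrMr// mul1r.
  rewrite ger0_norm ?mulr_ge0 ?powR_ge0 ?exprn_ge0//.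
  rewrite /g exponential_pdfE ?(ltW t0)//.
  apply: (@le_trans _ _ ((2 * (b + 1)) `^ b * expR (t / 2) * expR (- t))).
    apply: ler_pM; rewrite ?powR_ge0 ?exprn_ge0//; first exact: powR_expR_bound.
    have -> : - t = n.+1%:R * - (t / n.+1%:R) by rewrite mulrN mulrCA divff ?mulr1 ?gt_eqF.
    by rewrite expRM_natl lerXn2r ?nnegrE ?expR_ge0// expR_ge1Dx.
  rewrite -mulrA -expRD (_ : t / 2 - t = - 2^-1 * t); last by field.
  by rewrite le_eqVlt; apply/orP; left; apply/eqP; field.
move=> iG _ cG; apply: fine_cvg.
rewrite (_ : (_)%:E =
  (\int[mu]_(t in `]0%R, +oo[) (t `^ b * expR (- t))%:E)%E) //.
rewrite /Gamma/Rintegral addrK fineK//.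
exact: integrable_fin_num.
Qed.

(** The quotient whose limit is 1 / Gamma (b + 1) in Gauss's formula, read at
    n + 1 so that the base of the power is positive. *)
Definition euler_ratio b n : R := nbinom (b + 1) n.+1 / n.+1%:R `^ b.

(** With N = n + 1, this is 1 + b / (N + 1) <= (1 - 1 / (N + 1))^(-b), which
    follows from 1 + x <= exp x and ln (1 + x) <= x. *)
Lemma euler_ratio_noninc b : 0 <= b -> nonincreasing_seq (euler_ratio b).
Proof.
move=> b0; apply/nonincreasing_seqP => n; rewrite /euler_ratio.
rewrite (nbinomS _ n.+1) -mulrA ler_wpM2l ?nbinom_ge0 ?addr_ge0//.
rewrite ler_pdivrMr ?powR_gt0// [leRHS]mulrC ler_pdivlMr ?powR_gt0//.
set N : R := n.+1%:R.
have N0 : 0 < N by [].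
rewrite -natr1 -/N.
have -> : (b + 1 + N) / (N + 1) = 1 + b / (N + 1) by field; lra.
have -> : (N + 1) `^ b = N `^ b * ((N + 1) / N) `^ b.
  by rewrite -powRM ?divr_ge0 ?addr_ge0 ?(ltW N0)// mulrCA divff ?mulr1 ?gt_eqF.
rewrite mulrC ler_wpM2l ?powR_ge0//.
have -> : (N + 1) / N = (1 - (N + 1)^-1)^-1 by field; lra.
have l0 : 0 < 1 - (N + 1)^-1 by rewrite subr_gt0 invf_lt1 ?ltrDr//; lra.
rewrite /powR gt_eqF ?invr_gt0//.
apply: le_trans (expR_ge1Dx _) _; rewrite ler_expR ler_wpM2l//.
rewrite lnV ?posrE// lerNr; apply: le_ln1Dx.
by rewrite ltrN2 invf_lt1 ?ltrDr; lra.
Qed.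

(** The inverse ratio is [euler_beta] up to a factor tending to 1.  Gamma is
    positive since these inverses increase to it. *)
Lemma euler_ratio_cvg b : 0 <= b ->
  0 < Gamma (b + 1) /\ euler_ratio b @ \oo --> (Gamma (b + 1))^-1.
Proof.
move=> b0.
have er0 n : 0 < euler_ratio b n by rewrite divr_gt0 ?powR_gt0 ?nbinom_gt0// ltr_wpDl.
have E n : (euler_ratio b n)^-1 =
    euler_beta n.+1%:R b n.+1 * (1 + (b + 1) * n.+1%:R^-1).
  rewrite euler_betaE// /euler_ratio.
  rewrite (_ : (b + 1) * nbinom (b + 2) n.+1 =
    (b + 1 + n.+1%:R) * nbinom (b + 1) n.+1); last first.
    by rewrite nbinom_shift (_ : b + 1 + 1 = b + 2)//; ring.
  rewrite powRD; last by rewrite pnatr_eq0 implybT.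
  rewrite powRr1//.
  have := nbinom_gt0 n.+1 (_ : 0 < b + 1).
  have := @powR_gt0 R n.+1%:R b (ltr0Sn _ _).
  set p := powR _ _; set q := nbinom _ _; set N : R := n.+1%:R.
  move=> p0 /(_ (ltr_wpDl b0 ltr01)) q0.
  have N0 : 0 < N by [].
  by field; rewrite !gt_eqF//; lra.
have cV : (euler_ratio b n)^-1 @[n --> \oo] --> Gamma (b + 1).
  under eq_fun do rewrite E.
  rewrite (_ : Gamma (b + 1) = Gamma (b + 1) * (1 + (b + 1) * 0)); last first.
    by rewrite mulr0 addr0 mulr1.
  apply: cvgM; first exact: euler_beta_cvg.
  by apply: cvgD; [exact: cvg_cst|apply: cvgMl_tmp; exact: cvg_harmonic].
have G0 : 0 < Gamma (b + 1).
  apply: lt_le_trans (_ : (euler_ratio b 0)^-1 <= _); first by rewrite invr_gt0.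
  rewrite -(cvg_lim _ cV)//; apply: limr_ge; first by apply/cvg_ex; eexists; exact: cV.
  by apply: nearW => n; rewrite lef_pV2 ?posrE//; exact: euler_ratio_noninc.
split=> //.
rewrite (_ : euler_ratio b = fun n => (euler_ratio b n)^-1^-1); last first.
  by apply/funext => n; rewrite invrK.
by apply: cvgV => //; rewrite gt_eqF.
Qed.

End Euler.

(** * Dominated convergence for series *)

Section Tannery.
Context {R : realType}.
Implicit Types u h : R ^nat.

Lemma dominated_series_cvg u h : (forall k, `|u k| <= h k) ->
  cvgn (series h) -> cvgn (series u).
Proof.
move=> uh ch; apply: normed_cvg.
apply: (@series_le_cvg _ (fun k => `|u k|) h) => // k.
exact: le_trans (normr_ge0 _) (uh k).
Qed.

Lemma dominated_series_tail u h K : (forall k, `|u k| <= h k) ->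
  cvgn (series h) ->
  `|limn (series u) - series u K| <= limn (series h) - series h K.
Proof.
move=> uh ch; have cu := dominated_series_cvg uh ch.
have c1 : `|series u n - series u K| @[n --> \oo] -->
    `|limn (series u) - series u K|.
  by apply: cvg_norm; apply: cvgB => //; exact: cvg_cst.
have c2 : series h n - series h K @[n --> \oo] --> limn (series h) - series h K.
  by apply: cvgB => //; exact: cvg_cst.
apply: (ler_cvg_to c1 c2); exists K => // n /= Kn.
rewrite !sub_series_geq//; apply: le_trans (ler_norm_sum _ _ _) _.
exact: ler_sum.
Qed.

(** The tails are uniformly small by domination, so it is enough to compare
    partial sums of a fixed length. *)
Lemma tannery (f : nat -> R ^nat) (g h : R ^nat) :
  cvgn (series h) ->
  (\forall n \near \oo, forall k, `|f n k| <= h k) ->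
  (forall k, f n k @[n --> \oo] --> g k) ->
  limn (series (f n)) @[n --> \oo] --> limn (series g).
Proof.
move=> ch fh fg.
have gh k : `|g k| <= h k.
  have c1 : `|f n k| @[n --> \oo] --> `|g k| by apply: cvg_norm.
  apply: (ler_cvg_to c1 (cvg_cst (h k))).
  by apply: filterS fh => n; exact.
apply/cvgrPdist_le => e e0.
have e3 : 0 < e / 3 by rewrite divr_gt0.
have /cvgrPdist_lt/(_ _ e3)[K _ /(_ K (leqnn K))/= hK] := ch.
have fgK : series (f n) K @[n --> \oo] --> series g K.
  rewrite /series/=; apply: cvg_big => [|k _]; first exact: add_continuous.
  exact: fg.
have cK : \forall n \near \oo, `|series g K - series (f n) K| < e / 3.
  by move/cvgrPdist_lt : fgK; apply.
near=> n.
have fhn : forall k, `|f n k| <= h k by near: n.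
have cKn : `|series g K - series (f n) K| < e / 3 by near: n.
have tg := dominated_series_tail K gh ch.
have tf := dominated_series_tail K fhn ch.
have hK' := le_lt_trans (ler_norm _) hK.
rewrite (_ : _ - _ = (limn (series g) - series g K) +
   (series g K - series (f n) K) - (limn (series (f n)) - series (f n) K)); last by ring.
apply: le_trans (ler_normB _ _) _.
have := ler_normD (limn (series g) - series g K) (series g K - series (f n) K).
lra.
Unshelve. all: by end_near. Qed.

End Tannery.

(** * Decay of the Mittag-Leffler function on the negative half-line *)

Section MittagLefflerBound.
Context {R : realType}.
Variables (al : R).
Hypothesis al01 : 0 < al <= 1.

Lemma rGamma_ge1 (b : R) : 0 <= b -> rGamma (b + 1) = (Gamma (b + 1))^-1.
Proof.
move=> b0; rewrite /rGamma.
have -> : Num.truncn (1 - (b + 1)) = 0%N by apply/truncn0Pn; rewrite -ltNge; lra.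
by rewrite big_geq// mul1r addr0.
Qed.

Lemma relax_term_ratio x (k n : nat) :
  (- (x / n.+1%:R `^ al)) ^+ k * nbinom (al * k%:R + 1) n.+1 =
  (- x) ^+ k * euler_ratio (al * k%:R) n.
Proof.
rewrite /euler_ratio powRrM powR_mulrn ?powR_ge0// -mulNr expr_div_n; ring.
Qed.

(** Limit of [relax_coef1_ge0] and [relax_coef1_le] at y = x / (n + 1)^al. *)
Lemma mittag_leffler_bounds (x : R) : 0 <= x ->
  0 <= mittag_leffler al 1 (- x) /\
  mittag_leffler al 1 (- x) * (1 + x / Gamma (al + 1)) <= 1.
Proof.
move=> x0; have [a0 a1] := andP al01.
have al01' : 0 <= al <= 1 by rewrite ltW.
pose y (n : nat) := x / n.+1%:R `^ al.
(* n0 is the point from which x / (n + 1)^al < 1; the terms at n0 dominate. *)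
pose n0 := Num.truncn (x `^ al^-1).
have y01 n : (n0 <= n)%N -> 0 <= y n < 1.
  move=> n0n; rewrite divr_ge0 ?powR_ge0//= ltr_pdivrMr ?powR_gt0// mul1r.
  have -> : x = (x `^ al^-1) `^ al by rewrite -powRrM mulVf ?powRr1// gt_eqF.
  apply: gt0_ltr_powR => //; rewrite ?nnegrE ?powR_ge0//.
  apply: lt_le_trans (truncnS_gt _) _.
  by rewrite ler_nat ltnS.
have cU : relax_coef al (y n) 1 n.+1 @[n --> \oo] --> mittag_leffler al 1 (- x).
  apply: (@tannery _ _ _ (fun k => `|(- y n0) ^+ k * nbinom (al * k%:R + 1) n0.+1|)).
  - by apply: (normed_relax_term_cvg al01' (y01 _ (leqnn _))); rewrite ler01/=; lra.
  - exists n0 => // n /= n0n k; rewrite !relax_term_ratio normrM [leRHS]normrM.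
    rewrite ler_wpM2l//.
    have ak0 : 0 <= al * k%:R by rewrite mulr_ge0// ltW.
    have e0 m : 0 <= euler_ratio (al * k%:R) m.
      by rewrite divr_ge0 ?powR_ge0// nbinom_ge0// addr_ge0.
    by rewrite !ger0_norm//; exact: euler_ratio_noninc ak0 _ _ n0n.
  - move=> k; under eq_fun do rewrite relax_term_ratio.
    have ak0 : 0 <= al * k%:R by rewrite mulr_ge0// ltW.
    rewrite rGamma_ge1//; apply: cvgMl_tmp.
    exact: (euler_ratio_cvg ak0).2.
have [G0 cR] := euler_ratio_cvg (ltW a0).
split.
  apply: (ler_cvg_to (cvg_cst 0) cU); exists n0 => // n /= n0n.
  exact: relax_coef1_ge0 (y01 _ n0n) _.
have cL : relax_coef al (y n) 1 n.+1 * (1 + x * euler_ratio al n) @[n --> \oo] -->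
    mittag_leffler al 1 (- x) * (1 + x / Gamma (al + 1)).
  by apply: cvgM => //; apply: cvgD; [exact: cvg_cst|exact: cvgMl_tmp].
apply: (@ler_cvg_to _ _ _ _ _ _ _ _ cL (cvg_cst (1 : R))); exists n0 => // n /= n0n.
apply: le_trans (relax_coef1_le al01' (y01 _ n0n) n.+1).
rewrite /euler_ratio (addrC 1 al) /y.
by rewrite le_eqVlt; apply/orP; left; apply/eqP; ring.
Qed.

Lemma mittag_leffler_decay (x : R) : 0 < x ->
  `|mittag_leffler al 1 (- x)| <= Gamma (al + 1) / x.
Proof.
move=> x0; have [a0 a1] := andP al01.
have [G0 _] := euler_ratio_cvg (ltW a0).
have [E0 E1] := mittag_leffler_bounds (ltW x0).
rewrite ger0_norm// -[leRHS]mul1r -invf_div ler_pdivlMr ?divr_gt0//.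
by apply: le_trans E1; rewrite mulrDr lerDr mulr1.
Qed.

End MittagLefflerBound.

(** * Decay of the observation and failure of the estimator *)

Section Observation.
Context {R : realType}.
Variables (N : option nat) (lambda a : nat -> R) (al : R).
Hypothesis al01 : 0 < al <= 1.
Hypothesis lambda_gt0 : forall n, spectral_index N n -> 0 < lambda n.
Hypothesis suma : (\sum_(0 <= n <oo | spectral_index N n)
               (`|a n| / lambda n)%:E < +oo)%E.

Lemma observation_bound : exists2 C : R, 0 <= C & forall t : R, 0 < t ->
  `|observation N lambda a al t| <= C / t `^ al.
Proof.
have [a0 a1] := andP al01.
have [G0 _] := euler_ratio_cvg (ltW a0).
pose h k := if spectral_index N k then `|a k| / lambda k else 0.
have h0 k : 0 <= h k.
  by rewrite /h; case: ifPn => // /lambda_gt0 ?; rewrite divr_ge0// ltW.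
have ch : cvgn (series h).
  apply: nnseries_is_cvg => //; move: suma; rewrite eseries_mkcond.
  apply: le_lt_trans; rewrite le_eqVlt; apply/orP; left; apply/eqP.
  by apply: eq_eseriesr => k _; rewrite /h; case: ifP.
exists (Gamma (al + 1) * limn (series h)).
  rewrite mulr_ge0 ?(ltW G0)//; apply: limr_ge => //; apply: nearW => n.
  exact: sumr_ge0.
move=> t t0; have ta0 : 0 < t `^ al by rewrite powR_gt0.
pose u k := if spectral_index N k
  then a k * mittag_leffler al 1 (- (lambda k * t `^ al)) else 0.
have -> : observation N lambda a al t = limn (series u).
  rewrite /observation /spectral_sum; congr (lim (_ @ \oo)).
  by apply/funext => n; rewrite big_mkcond.
pose h' k := Gamma (al + 1) / t `^ al * h k.
have ch' : series h' @ \oo --> Gamma (al + 1) / t `^ al * limn (series h).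
  rewrite (_ : series h' = fun n => Gamma (al + 1) / t `^ al * series h n).
    exact: cvgMl_tmp.
  by apply/funext => n; rewrite /series/= mulr_sumr.
have uh k : `|u k| <= h' k.
  rewrite /u /h' /h; case: ifPn => [/lambda_gt0 l0|_]; last by rewrite normr0 mulr0.
  rewrite normrM (_ : _ * (_ / _) =
    `|a k| * (Gamma (al + 1) / (lambda k * t `^ al))).
    by rewrite ler_wpM2l// mittag_leffler_decay// mulr_gt0.
  by field; rewrite !gt_eqF.
have := dominated_series_tail 0 uh (cvgP _ ch').
rewrite /series/= !big_geq// !subr0 (cvg_lim _ ch')//.
by rewrite mulrAC.
Qed.

Lemma observation_cvg0 : observation N lambda a al t @[t --> +oo] --> 0.
Proof.
have [a0 a1] := andP al01.
have [C C0 HC] := observation_bound.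
apply/cvgr0Pnorm_lt => e e0.
have : \forall t \near +oo, (C / e) `^ al^-1 < t
  by apply: nbhs_pinfty_gt; rewrite num_real.
apply: filterS => t Ct.
have t0 : 0 < t by apply: le_lt_trans Ct; exact: powR_ge0.
apply: le_lt_trans (HC _ t0) _.
rewrite ltr_pdivrMr ?powR_gt0// mulrC -ltr_pdivrMr//.
have -> : C / e = ((C / e) `^ al^-1) `^ al.
  by rewrite -powRrM mulVf ?powRr1 ?divr_ge0 ?(ltW e0)// gt_eqF.
by apply: gt0_ltr_powR => //; rewrite ?nnegrE ?powR_ge0 ?(ltW t0).
Qed.

End Observation.

(** The noise dominates the vanishing signal, so the data ratio tends to 1. *)
Lemma log_ratio_estimator_cvg0 (R : realType) (m : nat) (rho delta : R)
    (M : R -> R) : 0 < rho -> delta != 0 -> M t @[t --> +oo] --> 0 ->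
  log_ratio_estimator m rho (M t + delta) (M (rho * t) + delta)
    @[t --> +oo] --> 0.
Proof.
move=> rho0 d0 M0.
have Mr0 : M (rho * t) @[t --> +oo] --> 0.
  have : rho * t @[t --> +oo] --> +oo by apply: gt0_cvgMry => //; exact: cvg_id.
  by move=> /cvg_comp; apply.
have Md (f : R -> R) : f t @[t --> +oo] --> 0 -> f t + delta @[t --> +oo] --> delta.
  by move=> f0; rewrite -[X in _ --> X]add0r; apply: cvgD => //; exact: cvg_cst.
rewrite /log_ratio_estimator -(mulr0 (- (m%:R * ln rho)^-1)) -(@ln1 R).
apply: cvgMl_tmp; apply: continuous_cvg; first exact: continuous_ln.
rewrite -[X in _ --> X](normr1 R) -(divff d0).
by apply: cvg_norm; apply: cvgM; [exact: Md|apply: cvgV => //; exact: Md].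
Qed.

Lemma not_time_uniformly_consistent (R : realType) (est : R -> R -> R) (al : R) :
  0 < al -> (forall delta, 0 < delta -> est delta t @[t --> +oo] --> 0) ->
  ~ time_uniformly_consistent est al.
Proof.
move=> a0 est0 [T T0 /(_ (al / 2))]; rewrite divr_gt0// => /(_ isT)[d d0].
move=> /(_ (d / 2)); rewrite divr_gt0//= ltr_pdivrMr// ltr_pMr// ltr1n => /(_ isT) H.
have h1 : \forall t \near +oo, `|est (d / 2) t| < al / 2.
  by apply: cvgr0_norm_lt; [apply: est0|]; rewrite divr_gt0.
have h2 : \forall t \near +oo, T <= t by apply: nbhs_pinfty_ge; rewrite num_real.
have [t [e1 /H e2]] := filter_ex (filterI h1 h2).
have := ler_normB (est (d / 2) t) (est (d / 2) t - al).
rewrite opprB addrCA subrr addr0 (gtr0_norm a0); lra.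
Qed.

Theorem proposition6p7 (R : realType) (H : completeNormedModType R)
    (dot : {dot H for @idfun R}) (D : set H) (A : H -> H)
    (N : option nat) (lambda : nat -> R) (v : nat -> H) (a : nat -> R)
    (alpha0 alpha1 alpha rho : R) (m : nat)
    (dotH : is_inner_product dot) (sepH : separable H)
    (linA : linear_on D A) (saA : self_adjoint dot D A)
    (posA : strictly_positive dot D A) (crA : compact_resolvent D A)
    (eigA : eigensystem dot D A N lambda v)
    (suma : (\sum_(0 <= n <oo | spectral_index N n)
               (`|a n| / lambda n)%:E < +oo)%E)
    (alpha0_gt0 : 0 < alpha0) (alpha01 : alpha0 <= alpha1)
    (alpha1_lt1 : alpha1 < 1)
    (m_ge1 : (1 <= m)%N)
    (S_eq0 : forall k, (1 <= k < m)%N -> resolvent_moment N lambda a k = 0)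
    (S_neq0 : resolvent_moment N lambda a m != 0)
    (c_neq0 : forall b, alpha0 <= b <= alpha1 -> asymptotic_coef m b != 0)
    (rho_gt1 : 1 < rho)
    (alphaI : alpha0 <= alpha <= alpha1) :
  let M := observation N lambda a alpha in
  let est delta t := log_ratio_estimator m rho (M t + delta)
                                               (M (rho * t) + delta) in
  [/\ forall delta, 0 < delta -> est delta t @[t --> +oo] --> 0,
      forall delta, 0 < delta -> ~ (est delta t @[t --> +oo] --> alpha)
    & ~ time_uniformly_consistent est alpha].
Proof.
have [a0 a1] := andP alphaI.
have al_gt0 : 0 < alpha by exact: lt_le_trans a0.
have al01 : 0 < alpha <= 1 by rewrite al_gt0 (le_trans a1) ?ltW.
move=> M est.
have est0 delta : 0 < delta -> est delta t @[t --> +oo] --> 0.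
  move=> d0; apply: log_ratio_estimator_cvg0; rewrite ?gt_eqF//.
    exact: lt_trans rho_gt1.
  exact: observation_cvg0 al01 (eigenvalue_gt0 eigA) suma.
split=> // [delta d0 est_al|]; last exact: not_time_uniformly_consistent al_gt0 est0.
have : alpha = 0 by apply: cvg_unique est_al (est0 _ d0).
by move=> E; rewrite E ltxx in al_gt0.
Qed.
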